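(* Let $r\geq 2$ be an integer. Then $$Z(\{2\}^r)+Z(1,\{2\}^{r-2},3)=\frac{\pi^{2r}}{(2r-1)!}.$$
   Context: Here $\{2\}^n$ denotes a string of $n$ twos (empty if $n=0$). For a complex number $a$ and a nonnegative integer $n$, let $(a)_0=1$ and $(a)_n=a(a+1)\cdots(a+n-1)$ for $n>0$. For $r\ge 1$ and positive integers $k_1,\dots,k_r$ with $k_r\geq 2$, define $$Z(k_1,\dots,k_r)=\sum_{0\leq n_1<\cdots<n_r}\frac{\left(\frac12\right)_{n_1}}{n_1!}\,\frac{1}{\left(n_1+\frac12\right)^{k_1}\cdots \left(n_r+\frac12\right)^{k_r}}\,\frac{n_r!}{\left(\frac12\right)_{n_r}},$$ where the sum is over integers $n_1,\dots,n_r$. *)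

(* Defs.v *)
From mathcomp Require Import all_boot all_order all_algebra.
From mathcomp Require Import all_classical all_reals all_analysis.

Set Implicit Arguments.
Unset Strict Implicit.
Unset Printing Implicit Defensive.

Import Order.TTheory GRing.Theory Num.Theory.

Local Open Scope classical_set_scope.
Local Open Scope ring_scope.

Definition pochhammer (R : pzSemiRingType) (a : R) (n : nat) : R :=
  \prod_(i < n) (a + i%:R).

(* [head 0 n] and [last 0 n] are n_1 and n_r; their default value 0 is used
   only when k is empty, a case with no mathematical meaning here. *)
Definition Zterm (R : realType) (k : seq nat) (n : (size k).-tuple nat) : R :=
  pochhammer 2^-1 (head 0%N n) / (head 0%N n)`!%:R
  * (\prod_(i < size k) ((tnth n i)%:R + 2^-1) ^+ nth 0%N k i)^-1
  * ((last 0%N n)`!%:R / pochhammer 2^-1 (last 0%N n)).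

(* All terms are positive, so the unordered sum in \bar R is meaningful
   whether or not the series converges; it is +oo exactly on divergence.
   An identity with a finite right-hand side thus includes convergence. *)
Definition Z (R : realType) (k : seq nat) : \bar R :=
  \esum_(n in [set n : (size k).-tuple nat | sorted ltn n])
    (Zterm R n)%:E.

(* Main.v *)
Require Import Defs.
From mathcomp Require Import all_boot all_order all_algebra.
From mathcomp Require Import all_classical all_reals all_analysis.
From mathcomp Require Import ring lra zify.

(** Write a_n = n + 1/2 and c_n = (1/2)_n / n!. The identity is the case k = 0
    of a statement about a family of deformed sums indexed by k in nat,

      S_k(p) = sum over k <= n_1 < ... < n_(p+1) of
               c_(n_1 - k) / (c_(n_r + k) a_(n_r + k))
               * (a_(n_r) + a_(n_1)) / (a_(n_1)^2 ... a_(n_r)^2),  r = p + 1,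

    which for k = 0 is the left-hand side. Its normalisation
    T_k(p) = S_k(p) / c_k^2 satisfies

      T_k(0) = T_(k+1)(0),
      T_k(p+1) = T_(k+1)(p+1) + T_(k+1)(p) / (k+1)^2,

    and T_k(p) tends to 0 as k grows, for every p > 0. These facts determine T
    from its constant value at p = 0 ([recursion_unique]).

    The recursion has the following source. Let M(s,t) be the transfer matrix
    of du = x v dt/t, dv = x u dt/(1-t), and rho_k = t^(k-1/2) (1-t)^(-1/2).
    Expanding in powers of t, the generating function of S_k(p) x^(2p) is the
    integral over s < t of tr M(s,t) rho_k(s) rho_k(t). As det M = 1, the trace
    is symmetric in s and t, so this is half of an integral over a square,
    that is, a 2x2 determinant of single integrals. Integration by parts
    expresses integrals against rho_k by integrals against rho_(k+1) through a
    2x2 matrix, of determinant ((k+1)^2 + x^2) / (k+1/2)^2. This factor is the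
    recursion. Below, both integrations by parts are done on the coefficients:
    [chain_c_shift] and [chain_hc_shift] are the one at the bottom index n_1,
    [Zsum_shift] is the one at the top index n_r, a telescoping sum.

    The moments of theta^(2p) / (2p)! against cos(theta)^(2k) on [0, pi/2],
    normalised by their value at p = 0 and multiplied by 4^p, satisfy the same
    recursion by two more integrations by parts, and also tend to 0. Hence
    T_k(p) is T_0(0) times that normalised moment ([ZnormE]). At k = 0 the
    cosine disappears and the normalised moment is pi^(2p) / (2p+1)!. The
    constant T_0(0), twice the sum of the 1 / a_n^2, equals pi^2 by Basel's sum,
    which in turn is what the recursion of the moments says between p = 0 and
    p = 1. *)

Set Implicit Arguments.
Unset Strict Implicit.
Unset Printing Implicit Defensive.
Import Order.TTheory GRing.Theory Num.Theory numFieldNormedType.Exports.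
Local Open Scope classical_set_scope.
Local Open Scope ring_scope.

(** * The deformed sums and their recursion in the shift *)

Section shifted_sums.
Context {R : realType}.
Implicit Types (g : nat -> R) (k m n p N : nat).

Definition nhalf n : R := n%:R + 2^-1.

Definition cbin n : R := pochhammer 2^-1 n / n`!%:R.

(** This is n! / (1/2)_(n+1), the Beta value B(n+1, 1/2), that is, the integral
    of t^n (1-t)^(-1/2) over [0, 1]. *)
Definition beta_half n : R := (cbin n * nhalf n)^-1.

(** The sum over n_1 < ... < n_p < m of g(n_1) / (a_(n_1) ... a_(n_p))^2: one
    index at a time is added at the top, which turns every later argument into
    an induction on the bound m. *)
Fixpoint chain g p m : R :=
  if p is p'.+1 then \sum_(i < m) chain g p' i / nhalf i ^+ 2 else g m.

(** The coefficients of t^(k-1/2) (1-t)^(-1/2) = sum of c_(m-k) t^(m-1/2). *)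
Definition cbin_from k m : R := if (m < k)%N then 0 else cbin (m - k).

Definition chain_c k : nat -> nat -> R := chain (cbin_from k).
Definition chain_hc k : nat -> nat -> R := chain (fun m => nhalf m * cbin_from k m).

(** The sum S_k(p) restricted to n_r < N. The numerator a_(n_r) + a_(n_1) is
    split, and a_(n_1) is absorbed into the bottom weight of the second chain. *)
Definition Zsum k p N : R :=
  \sum_(m < N) beta_half (m + k) * (chain_c k p m / nhalf m + chain_hc k p m / nhalf m ^+ 2).

Lemma nhalf_gt0 n : 0 < nhalf n.
Proof. by rewrite ltr_wpDl ?invr_gt0. Qed.

Lemma nhalf_neq0 n : nhalf n != 0.
Proof. by rewrite gt_eqF ?nhalf_gt0. Qed.

Lemma nhalfS n : nhalf n.+1 = nhalf n + 1.
Proof. by rewrite /nhalf -natr1 addrAC. Qed.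

Lemma pochhammerS (a : R) n :
  pochhammer a n.+1 = pochhammer a n * (a + n%:R).
Proof. by rewrite /pochhammer big_ord_recr. Qed.

Lemma pochhammer_gt0 n : 0 < pochhammer (2^-1 : R) n.
Proof.
by apply: prodr_gt0 => i _; rewrite addrC; exact: (nhalf_gt0 i).
Qed.

Lemma factr_gt0 n : 0 < n`!%:R :> R.
Proof. by rewrite ltr0n fact_gt0. Qed.

Lemma cbin0 : cbin 0 = 1.
Proof. by rewrite /cbin /pochhammer big_ord0 fact0 divr1. Qed.

Lemma cbinS n : cbin n.+1 * n.+1%:R = cbin n * nhalf n.
Proof.
rewrite /cbin pochhammerS factS natrM /nhalf (addrC 2^-1).
have := lt0r_neq0 (factr_gt0 n); have : n.+1%:R != 0 :> R by rewrite pnatr_eq0.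
move=> h1 h2; field.
by rewrite h2 nat1r h1.
Qed.

Lemma cbin_gt0 n : 0 < cbin n.
Proof. by rewrite divr_gt0 ?pochhammer_gt0 ?factr_gt0. Qed.

Lemma beta_half_gt0 n : 0 < beta_half n.
Proof. by rewrite invr_gt0 mulr_gt0 ?cbin_gt0 ?nhalf_gt0. Qed.

Lemma beta_halfS n : beta_half n.+1 * nhalf n.+1 = beta_half n * n.+1%:R.
Proof.
by rewrite /beta_half -(cbinS n) !invfM !divfK ?nhalf_neq0 ?pnatr_eq0.
Qed.

Lemma chainS g p m : chain g p.+1 m.+1 = chain g p.+1 m + chain g p m / nhalf m ^+ 2.
Proof. by rewrite /= big_ord_recr. Qed.

Lemma chain0 g p : chain g p.+1 0 = 0.
Proof. by rewrite /= big_ord0. Qed.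

Lemma chain_ge0 g p m : (forall m, 0 <= g m) -> 0 <= chain g p m.
Proof.
move=> g0; elim: p m => [//|p IH] m /=.
by apply: sumr_ge0 => i _; rewrite divr_ge0 ?exprn_ge0 ?(ltW (nhalf_gt0 _)).
Qed.

Lemma cbin_fromS k m : cbin_from k.+1 m.+1 = cbin_from k m.
Proof. by rewrite /cbin_from ltnS subSS. Qed.

(** This is c_n n = c_(n-1) (n - 1/2) with n = m - k, written so that it also
    holds for m <= k, where its terms vanish. *)
Lemma cbin_from_rec k m : (nhalf m - nhalf k - 2^-1) * cbin_from k.+1 m = (nhalf m - nhalf k) * cbin_from k m.
Proof.
rewrite /cbin_from ltnS; case: (ltngtP m k) => [mk|km|->]; rewrite ?mulr0 //; last first.
  by rewrite subrr mul0r.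
have e : (m - k = (m - k.+1).+1)%N by lia.
rewrite e; have := cbinS (m - k.+1).
have -> : nhalf m - nhalf k = (m - k.+1).+1%:R.
  by rewrite /nhalf -e natrB ?(ltnW km)//; ring.
move=> h; rewrite [RHS]mulrC h mulrC; congr (_ * _).
by rewrite /nhalf -natr1; lra.
Qed.

Lemma cbin_from_ge0 k m : 0 <= cbin_from k m.
Proof. by rewrite /cbin_from; case: ifP => // _; exact/ltW/cbin_gt0. Qed.

Lemma chain_c_ge0 k p m : 0 <= chain_c k p m.
Proof. exact/chain_ge0/cbin_from_ge0. Qed.

Lemma chain_hc_ge0 k p m : 0 <= chain_hc k p m.
Proof. by apply: chain_ge0 => i; rewrite mulr_ge0 ?cbin_from_ge0 ?(ltW (nhalf_gt0 _)). Qed.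

Lemma chain_c0 k m : chain_c k 0 m = cbin_from k m. Proof. by []. Qed.
Lemma chain_hc0 k m : chain_hc k 0 m = nhalf m * cbin_from k m. Proof. by []. Qed.
Lemma chain_cS0 k p : chain_c k p.+1 0 = 0. Proof. exact: chain0. Qed.
Lemma chain_hcS0 k p : chain_hc k p.+1 0 = 0. Proof. exact: chain0. Qed.

Lemma chain_cS k p m : chain_c k p.+1 m.+1 = chain_c k p.+1 m + chain_c k p m / nhalf m ^+ 2.
Proof. exact: chainS. Qed.

Lemma chain_hcS k p m : chain_hc k p.+1 m.+1 = chain_hc k p.+1 m + chain_hc k p m / nhalf m ^+ 2.
Proof. exact: chainS. Qed.

(** First row of the change of weight from k to k+1 at the bottom index. The
    coefficients do not depend on m. Both sides vanish at m = 0 and add an index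
    in the same way, so only the case p = 0 has content, and there the
    increments in m agree by [cbin_from_rec]. The term with one index less is the
    part of order x^2 of the matrix entry. *)
Lemma chain_c_shift k p m :
  chain_c k p.+1 m = (1 + (2 * nhalf k)^-1) * chain_c k.+1 p.+1 m
    + chain_c k.+1 p m / nhalf k ^+ 2 + chain_hc k.+1 p.+1 m / (2 * nhalf k ^+ 2).
Proof.
have hk := nhalf_neq0 k; have h2 : 2 != 0 :> R by rewrite pnatr_eq0.
elim: p m => [|p IHp]; elim=> [|m IHm].
- by rewrite ?chain_cS0 !chain_hcS0 chain_c0 /cbin_from /= !mul0r !mulr0 !addr0.
- rewrite !chain_cS !chain_hcS IHm !chain_c0 chain_hc0 cbin_fromS.
  have e := cbin_from_rec k m; have hm := nhalf_neq0 m.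
  apply: (@mulfI _ (2 * nhalf k ^+ 2 * nhalf m ^+ 2)).
    by rewrite !mulf_neq0 ?expf_neq0.
  apply/eqP; rewrite -subr_eq0; apply/eqP.
  (* The difference of both sides is a multiple of cbin_from_rec. *)
  transitivity (2 * (nhalf m + nhalf k)
    * ((nhalf m - nhalf k - 2^-1) * cbin_from k.+1 m - (nhalf m - nhalf k) * cbin_from k m)).
    by field; rewrite hk hm.
  by rewrite e subrr mulr0.
- by rewrite ?chain_cS0 !chain_hcS0; ring.
- rewrite !chain_cS !chain_hcS IHm IHp.
  have hm := nhalf_neq0 m.
  by field; rewrite hk hm.
Qed.

(** Second row of the change of weight at the bottom index, proved in the same
    way. *)
Lemma chain_hc_shift k p m :
  chain_hc k p.+1 m = chain_c k.+1 p m / nhalf k + (1 + (2 * nhalf k)^-1) * chain_hc k.+1 p.+1 m.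
Proof.
have hk := nhalf_neq0 k; have h2 : 2 != 0 :> R by rewrite pnatr_eq0.
elim: p m => [|p IHp]; elim=> [|m IHm].
- by rewrite ?chain_cS0 !chain_hcS0 chain_c0 /cbin_from /= !mul0r !mulr0 !addr0.
- rewrite !chain_hcS IHm !chain_c0 !chain_hc0 cbin_fromS.
  have e := cbin_from_rec k m; have hm := nhalf_neq0 m.
  apply: (@mulfI _ (nhalf k * nhalf m)); first by rewrite mulf_neq0.
  apply/eqP; rewrite -subr_eq0; apply/eqP.
  transitivity ((nhalf m - nhalf k - 2^-1) * cbin_from k.+1 m - (nhalf m - nhalf k) * cbin_from k m).
    by field; rewrite hk hm.
  by rewrite e subrr.
- by rewrite ?chain_cS0 !chain_hcS0; ring.
- rewrite !chain_cS !chain_hcS IHm IHp.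
  have hm := nhalf_neq0 m.
  by field; rewrite hk hm.
Qed.

Lemma beta_half_step k m :
  beta_half (m.+1 + k) * (nhalf m + nhalf k + 2^-1) = beta_half (m + k) * (nhalf m + nhalf k).
Proof.
have -> : nhalf m + nhalf k + 2^-1 = nhalf (m + k).+1 by rewrite nhalfS /nhalf natrD; lra.
rewrite addSn beta_halfS; congr (_ * _).
by rewrite -addn1 !natrD /nhalf; lra.
Qed.

Lemma ZsumS k p N : Zsum k p N.+1 = Zsum k p N
  + beta_half (N + k) * (chain_c k p N / nhalf N + chain_hc k p N / nhalf N ^+ 2).
Proof. by rewrite /Zsum big_ord_recr. Qed.

(** For p = 0 both integrations by parts merge into one telescoping sum. *)
Lemma Zsum_shift0 k N :
  nhalf k ^+ 2 * Zsum k 0 N = (nhalf k + 2^-1) ^+ 2 * Zsum k.+1 0 N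
    + (nhalf k + nhalf k + 2^-1) * (beta_half (N + k) * cbin_from k.+1 N).
Proof.
elim: N => [|N IH]; first by rewrite /Zsum !big_ord0 /cbin_from /= !mulr0 addr0.
rewrite !ZsumS !mulrDr IH cbin_fromS addnS -addSn.
have e := beta_half_step k N; have e' := cbin_from_rec k N.
have hN := nhalf_neq0 N; rewrite !chain_c0 !chain_hc0.
have h : nhalf N + nhalf k + 2^-1 != 0.
  by apply: lt0r_neq0; rewrite addr_gt0 ?invr_gt0 ?ltr0n// addr_gt0 ?nhalf_gt0.
have h1 : (nhalf N + nhalf k) * 2 + 1 != 0 :> R.
  by apply: lt0r_neq0; rewrite addr_gt0 ?ltr01// mulr_gt0 ?ltr0n// addr_gt0 ?nhalf_gt0.
have -> : beta_half (N.+1 + k) = beta_half (N + k) * (nhalf N + nhalf k) / (nhalf N + nhalf k + 2^-1).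
  by rewrite -e mulfK.
apply/eqP; rewrite -subr_eq0; apply/eqP.
(* The multiplier comes from the coefficient of cbin_from k N, which is
   divisible by nhalf N - nhalf k. *)
transitivity (beta_half (N + k) * (2 * nhalf k * (nhalf N + nhalf k) + nhalf N / 2 + nhalf k)
    / (nhalf N * (nhalf N + nhalf k + 2^-1))
  * ((nhalf N - nhalf k - 2^-1) * cbin_from k.+1 N - (nhalf N - nhalf k) * cbin_from k N)).
  by field; rewrite hN h1.
by rewrite e' subrr mulr0.
Qed.

(** Change of weight at the top index, applied to the two rows above. The
    coefficients (a_k + 1/2) and 1 of the boundary term are those for which the
    increments in N agree. *)
Lemma Zsum_shift k p N :
  nhalf k ^+ 2 * Zsum k p.+1 N = (nhalf k + 2^-1) ^+ 2 * Zsum k.+1 p.+1 N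
    + Zsum k.+1 p N
    + ((nhalf k + 2^-1) * chain_c k.+1 p.+1 N - chain_hc k.+1 p.+1 N) * beta_half (N + k).
Proof.
elim: N => [|N IH].
  by rewrite /Zsum !big_ord0 chain_cS0 chain_hcS0; ring.
rewrite !ZsumS !mulrDr IH (chain_c_shift k) (chain_hc_shift k) addnS -addSn.
rewrite !chain_cS !chain_hcS.
have e := beta_half_step k N.
have hN := nhalf_neq0 N; have hk := nhalf_neq0 k.
have h : nhalf N + nhalf k + 2^-1 != 0.
  by apply: lt0r_neq0; rewrite addr_gt0 ?invr_gt0 ?ltr0n// addr_gt0 ?nhalf_gt0.
have h1 : (nhalf N + nhalf k) * 2 + 1 != 0 :> R.
  by apply: lt0r_neq0; rewrite addr_gt0 ?ltr01// mulr_gt0 ?ltr0n// addr_gt0 ?nhalf_gt0.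
have -> : beta_half (N.+1 + k) = beta_half (N + k) * (nhalf N + nhalf k) / (nhalf N + nhalf k + 2^-1).
  by rewrite -e mulfK.
by field; rewrite hN hk h1.
Qed.

Lemma beta_half_sqr_le n : beta_half n ^+ 2 * n.+1%:R <= 4.
Proof.
elim: n => [|n IH].
  rewrite /beta_half cbin0 /nhalf mulr1n add0r mul1r invrK; lra.
apply: le_trans IH.
have := beta_halfS n; have h := nhalf_gt0 n.+1.
move=> /(congr1 (fun x => x / nhalf n.+1)); rewrite mulfK ?nhalf_neq0// => ->.
have hn : 0 <= n%:R :> R by [].
have e : nhalf n.+1 = n%:R + 1 + 2^-1 by rewrite /nhalf -natr1.
have e2 : n.+2%:R = n%:R + 2 :> R by rewrite -!natr1; lra.
rewrite e2 -(natr1 n); move: (beta_half n) => q; rewrite expr_div_n exprMn.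
rewrite mulrAC ler_pdivrMr ?exprn_gt0//.
have h4 : (n%:R + 1) * (n%:R + 2) <= nhalf n.+1 ^+ 2 :> R by rewrite e; nra.
have h5 : 0 <= q ^+ 2 * (n%:R + 1) by rewrite mulr_ge0 ?sqr_ge0 ?addr_ge0.
by have := ler_wpM2l h5 h4; lra.
Qed.

(** This removes the boundary terms of [Zsum_shift] as N grows; the chains that
    multiply them stay bounded. *)
Lemma beta_half_cvg0 k : (fun N => beta_half (N + k)) @ \oo --> (0 : R).
Proof.
rewrite (cvg_shiftn k (fun n => beta_half n : R)).
apply/cvgr0Pnorm_lt => e e0.
near=> n.
have h := beta_half_sqr_le n; have h0 := beta_half_gt0 n.
rewrite gtr0_norm// -(@ltr_pXn2r _ 2) ?nnegrE ?ltW//.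
have h1 : 4 / e ^+ 2 < n.+1%:R.
  apply: lt_trans (_ : n%:R < _); last by rewrite ltr_nat.
  by near: n; exact: nbhs_infty_gtr.
rewrite ltr_pdivrMr ?exprn_gt0// in h1.
rewrite -(@ltr_pM2r _ n.+1%:R)//.
by rewrite mulrC in h1; exact: le_lt_trans h1.
Unshelve. all: by end_near. Qed.

Lemma bounded_mul_cvg0 (u v : nat -> R) (C : R) :
    (forall n, 0 <= u n <= C) -> (forall n, 0 <= v n) -> v @ \oo --> (0 : R) ->
  (fun n => u n * v n) @ \oo --> (0 : R).
Proof.
move=> uC v0 vcvg.
apply: (@squeeze_cvgr _ _ _ _ (fun=> 0) (fun n => C * v n)).
- apply: nearW => n; have /andP[u0 uc] := uC n.
  by rewrite mulr_ge0//= ler_wpM2r.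
- exact: cvg_cst.
- by rewrite -(mulr0 C); apply: cvgMl_tmp.
Qed.

Lemma sum_nhalf_le m : \sum_(i < m) (nhalf i ^+ 2)^-1 <= 5 :> R.
Proof.
case: m => [|m]; first by rewrite big_ord0.
suff : \sum_(i < m.+1) (nhalf i ^+ 2)^-1 <= 5 - m.+1%:R^-1 :> R.
  by move/le_trans; apply; rewrite gerBl invr_ge0.
elim: m => [|m IH].
  rewrite big_ord1 /nhalf /= add0r exprVn invrK invr1; lra.
rewrite big_ord_recr /=.
have h : (nhalf m.+1 ^+ 2)^-1 <= m.+1%:R^-1 - m.+2%:R^-1 :> R.
  have hm : 0 <= m%:R :> R by [].
  have -> : m.+1%:R^-1 - m.+2%:R^-1 = ((m%:R + 1) * (m%:R + 2))^-1 :> R.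
    rewrite -!natr1; field; apply/andP; split; apply: lt0r_neq0; lra.
  rewrite lef_pV2 ?posrE ?exprn_gt0 ?nhalf_gt0 ?mulr_gt0 ?ltr_wpDl//.
  by rewrite /nhalf -(natr1 m); nra.
by apply: le_trans (lerD IH h) _; rewrite addrA subrK.
Qed.

Lemma chain_le g p (C : R) : 0 <= C -> (forall m, chain g p m <= C) ->
  forall m, chain g p.+1 m <= C * 5.
Proof.
move=> C0 gC m /=.
apply: le_trans (_ : C * \sum_(i < m) (nhalf i ^+ 2)^-1 <= _); last first.
  by rewrite ler_wpM2l ?sum_nhalf_le.
rewrite mulr_sumr ler_sum// => i _.
by rewrite ler_wpM2r ?invr_ge0 ?exprn_ge0 ?(ltW (nhalf_gt0 _)).
Qed.

Lemma cbin_le1 n : cbin n <= 1.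
Proof.
elim: n => [|n IH]; first by rewrite cbin0.
rewrite -(@ler_pM2r _ n.+1%:R)// cbinS.
by rewrite ler_pM ?(ltW (cbin_gt0 _)) ?(ltW (nhalf_gt0 _))// /nhalf -(natr1 n); lra.
Qed.

Lemma chain_c_bounded k p : exists2 C, 0 <= C & forall m, chain_c k p m <= C.
Proof.
elim: p => [|p [C C0 IH]].
  exists 1 => // m; rewrite chain_c0 /cbin_from; case: ifP => // _.
  exact: cbin_le1.
by exists (C * 5); [rewrite mulr_ge0|exact: chain_le].
Qed.

(** The series of the c_n / a_(k+n) converges because c_n / (n+1) is the
    telescoping difference 2 (c_n - c_(n+1)) and a_(k+n) >= (n+1) / 2. *)
Lemma chain_hc1_le k n : chain_hc k 1 (k + n) + 4 * cbin n <= 4.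
Proof.
elim: n => [|n IH].
  rewrite addn0 cbin0 mulr1 gerDr /chain_hc /= big1// => i _.
  by rewrite /cbin_from ltn_ord mulr0 mul0r.
rewrite addnS chain_hcS chain_hc0; apply: le_trans IH.
rewrite /cbin_from ltnNge leq_addr /= addKn.
rewrite -addrA lerD2l.
have h := cbinS n; have h1 := nhalf_neq0 (k + n).
have n1 : 0 < n.+1%:R :> R by [].
have e : cbin n.+1 = cbin n * nhalf n / n.+1%:R by rewrite -h mulfK ?gt_eqF.
have -> : nhalf (k + n) * cbin n / nhalf (k + n) ^+ 2 = cbin n / nhalf (k + n).
  by field.
have h2 : cbin n / nhalf (k + n) <= cbin n * (2 / n.+1%:R).
  rewrite ler_wpM2l ?(ltW (cbin_gt0 _))// -invf_div lef_pV2 ?posrE ?nhalf_gt0 ?divr_gt0//.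
  by rewrite /nhalf -natr1 natrD; have : 0 <= k%:R :> R by []; have : 0 <= n%:R :> R by []; lra.
apply: le_trans (lerD h2 (lexx _)) _.
rewrite e /nhalf -(natr1 n) le_eqVlt; apply/orP; left; apply/eqP.
by field; rewrite natr1 gt_eqF.
Qed.

Lemma chain_mono g p : (forall m, 0 <= g m) -> {homo chain g p.+1 : m n / (m <= n)%N >-> m <= n}.
Proof.
move=> g0; apply: homo_leq => [//|y x z|m]; first exact: le_trans.
by rewrite chainS lerDl divr_ge0 ?chain_ge0// exprn_ge0 ?(ltW (nhalf_gt0 _)).
Qed.

Lemma chain_hc_bounded k p : exists2 C, 0 <= C & forall m, chain_hc k p.+1 m <= C.
Proof.
elim: p => [|p [C C0 IH]].
  exists 4 => // m.
  apply: le_trans (_ : chain_hc k 1 (k + m) <= _).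
    apply: chain_mono; last exact: leq_addl.
    by move=> i; rewrite mulr_ge0 ?cbin_from_ge0 ?(ltW (nhalf_gt0 _)).
  by apply: le_trans (chain_hc1_le k m); rewrite lerDl mulr_ge0 ?(ltW (cbin_gt0 _)).
by exists (C * 5); [rewrite mulr_ge0|exact: chain_le].
Qed.

(** The factor a at the bottom index is at most its value at the top. *)
Lemma chain_hc_le k p m : chain_hc k p m <= nhalf m * chain_c k p m.
Proof.
elim: p m => [|p IHp]; elim=> [|m IHm]; rewrite ?chain_c0 ?chain_hc0//.
  by rewrite chain_cS0 chain_hcS0 mulr0.
rewrite chain_cS chain_hcS nhalfS mulrDl mulrDr.
have := nhalf_gt0 m => hm.
have h : chain_hc k p m / nhalf m ^+ 2 <= nhalf m * (chain_c k p m / nhalf m ^+ 2).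
  by rewrite mulrA ler_wpM2r ?invr_ge0 ?exprn_ge0 ?(ltW hm).
have h1 : 0 <= 1 * (chain_c k p.+1 m + chain_c k p m / nhalf m ^+ 2).
  by rewrite mul1r addr_ge0 ?divr_ge0 ?chain_c_ge0 ?exprn_ge0 ?ltW.
lra.
Qed.

(** The part of [Zsum] with the weight c at the bottom. It is at least half of
    the whole ([Zsum_le]), and exactly half for p = 0. *)
Definition halfsum k p N : R := \sum_(m < N) beta_half (m + k) * chain_c k p m / nhalf m.

Lemma halfsumS k p N : halfsum k p N.+1 = halfsum k p N + beta_half (N + k) * chain_c k p N / nhalf N.
Proof. by rewrite /halfsum big_ord_recr. Qed.

Lemma chain_c_eq0 k p m : (m < k)%N -> chain_c k p m = 0.
Proof.
elim: p m => [|p IHp] m; first by rewrite chain_c0 /cbin_from => ->.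
move=> mk; rewrite /chain_c /= big1// => i _.
by rewrite -/(chain_c k p i) IHp ?mul0r// (ltn_trans _ mk).
Qed.

(** Write B for [beta_half]. For m >= k one has
    B_(m+k) / a_m <= 6 (B_(m+k) - B_(m+k+1)), so that the sum over the top index
    telescopes to at most 6 B_(n+k), where n is the index below it. The weight
    1 / a_n^2 of that index then supplies the factor 1 / a_n of the shorter sum
    and a further factor, at most 1 / a_k. The second term on the left is the
    remainder of this summation by parts. *)
Lemma halfsum_decay k p N :
  halfsum k p.+1 N + 6 * beta_half (N + k) * chain_c k p.+1 N <= 6 / nhalf k * halfsum k p N.
Proof.
elim: N => [|N IH].
  by rewrite /halfsum !big_ord0 chain_cS0 !mulr0 addr0.
rewrite !halfsumS.
have [Nk|kN] := ltnP N k.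
  have ap0 q := chain_c_eq0 q Nk.
  by move: IH; rewrite chain_cS !ap0 !(mul0r, mulr0, addr0).
rewrite mulrDr chain_cS.
have := beta_half_step k N; have q0 := beta_half_gt0 (N + k); have q1 := beta_half_gt0 (N.+1 + k).
have aN := nhalf_gt0 N; have ak := nhalf_gt0 k.
have akN : nhalf k <= nhalf N by rewrite lerD2r ler_nat.
have a1 : 2^-1 <= nhalf N by rewrite lerDr.
have x0 := chain_c_ge0 k p.+1 N; have y0 := chain_c_ge0 k p N.
set q := beta_half (N + k) in q0 IH *; set q' := beta_half (N.+1 + k) in q1 *.
set a := nhalf N in aN akN a1 *; set c := nhalf k in ak akN IH *.
set x := chain_c k p.+1 N in x0 IH *; set y := chain_c k p N in y0 *.
move=> e.
have h1 : q * x / a <= 6 * (q - q') * x.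
  rewrite mulrAC ler_wpM2r// ler_pdivrMr//.
  have ac0 : 0 < a + c + 2^-1 by lra.
  have -> : q' = q * (a + c) / (a + c + 2^-1) by rewrite -e mulfK ?gt_eqF.
  have -> : q - q * (a + c) / (a + c + 2^-1) = q / (a + c + 2^-1) / 2.
    by field; apply: lt0r_neq0; lra.
  have -> : 6 * (q / (a + c + 2^-1) / 2) * a = q * (3 * a / (a + c + 2^-1)).
    by field; apply: lt0r_neq0; lra.
  by rewrite ler_peMr ?(ltW q0)// ler_pdivlMr// mul1r; lra.
have h2 : 6 * q' * (y / a ^+ 2) <= 6 / c * (q * y / a).
  have qq : q' <= q.
    rewrite -(@ler_pM2r _ (a + c + 2^-1)) ?e ?ler_wpM2l ?(ltW q0)//; lra.
  have -> : 6 / c * (q * y / a) = 6 * q * (y / (c * a)).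
    by field; rewrite !gt_eqF.
  have i1 : (a ^+ 2)^-1 <= (c * a)^-1.
    by rewrite lef_pV2 ?posrE ?exprn_gt0 ?mulr_gt0// expr2 ler_wpM2r// ltW.
  have i2 : 0 <= (a ^+ 2)^-1 by rewrite invr_ge0 exprn_ge0 ?ltW.
  apply: ler_pM.
  - by rewrite mulr_ge0 ?ltW.
  - by rewrite mulr_ge0.
  - by rewrite ler_wpM2l.
  - by rewrite ler_wpM2l.
have -> : 6 * q' * (x + y / a ^+ 2) = 6 * q' * x + 6 * q' * (y / a ^+ 2) by rewrite mulrDr.
lra.
Qed.

Lemma Zsum0E k N : Zsum k 0 N = 2 * halfsum k 0 N :> R.
Proof.
rewrite /Zsum /halfsum mulr_sumr; apply: eq_bigr => i _.
by rewrite chain_c0 chain_hc0; field; exact: nhalf_neq0.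
Qed.

Lemma Zsum_le k p N : Zsum k p N <= 2 * halfsum k p N :> R.
Proof.
rewrite /Zsum /halfsum mulr_sumr ler_sum// => i _.
have -> : 2 * (beta_half (i + k) * chain_c k p i / nhalf i) =
  beta_half (i + k) * (chain_c k p i / nhalf i + (nhalf i * chain_c k p i) / nhalf i ^+ 2) :> R.
  by field; exact: nhalf_neq0.
rewrite ler_wpM2l ?(ltW (beta_half_gt0 _))// lerD2l.
by rewrite ler_wpM2r ?invr_ge0 ?exprn_ge0 ?(ltW (nhalf_gt0 _))// chain_hc_le.
Qed.

Lemma halfsum_geom k p N : halfsum k p N <= (6 / nhalf k) ^+ p * halfsum k 0 N :> R.
Proof.
elim: p => [|p IH]; first by rewrite expr0 mul1r.
apply: le_trans (_ : 6 / nhalf k * halfsum k p N <= _).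
  apply: le_trans (halfsum_decay k p N).
  by rewrite lerDl mulr_ge0 ?chain_c_ge0// mulr_ge0 ?(ltW (beta_half_gt0 _)).
by rewrite exprS -[leRHS]mulrA ler_wpM2l// divr_ge0 ?(ltW (nhalf_gt0 _)).
Qed.

(** This gives both the convergence of the sums in N, by comparison with p = 0,
    and their decay as k grows. *)
Lemma Zsum_geom k p N : Zsum k p N <= (6 / nhalf k) ^+ p * Zsum k 0 N :> R.
Proof.
rewrite Zsum0E mulrCA; apply: le_trans (Zsum_le _ _ _) _.
by rewrite ler_wpM2l// halfsum_geom.
Qed.

Lemma Zsum_nondecreasing k p : {homo (Zsum k p : nat -> R) : m n / (m <= n)%N >-> m <= n}.
Proof.
apply: homo_leq => [//|y x z|m]; first exact: le_trans.
rewrite ZsumS lerDl mulr_ge0 ?(ltW (beta_half_gt0 _))// addr_ge0 ?divr_ge0 ?exprn_ge0 ?chain_c_ge0 ?chain_hc_ge0 ?(ltW (nhalf_gt0 _))//.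
Qed.

Lemma Zsum_ge0 k p N : 0 <= Zsum k p N :> R.
Proof. by apply: le_trans (Zsum_nondecreasing k p (leq0n N)); rewrite /Zsum big_ord0. Qed.

Lemma Zsum00 N : Zsum 0 0 N = 2 * \sum_(i < N) (nhalf i ^+ 2)^-1 :> R.
Proof.
rewrite Zsum0E /halfsum; congr (_ * _); apply: eq_bigr => i _.
rewrite chain_c0 /cbin_from /= subn0 addn0 /beta_half.
by field; rewrite nhalf_neq0 gt_eqF// cbin_gt0.
Qed.

(** The boundary term in [Zsum_shift0] is nonnegative, so the sums for p = 0
    decrease with k. *)
Lemma Zsum_le10 k N : Zsum k 0 N <= 10 :> R.
Proof.
elim: k => [|k IH].
  rewrite Zsum00; have := sum_nhalf_le N.
  by move=> h; lra.
apply: le_trans IH.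
have hk := nhalf_gt0 k.
have h2 : 0 < nhalf k ^+ 2 :> R by rewrite exprn_gt0.
rewrite -(ler_pM2l h2) Zsum_shift0.
apply: le_trans (_ : (nhalf k + 2^-1) ^+ 2 * Zsum k.+1 0 N <= _); last first.
  rewrite lerDl mulr_ge0 ?addr_ge0 ?(ltW (nhalf_gt0 _))//.
  by rewrite mulr_ge0 ?cbin_from_ge0 ?(ltW (beta_half_gt0 _)).
by rewrite ler_wpM2r ?Zsum_ge0//; nra.
Qed.

Let cvgn_uniq (u : nat -> R) (a b : R) :
  u @ \oo --> a -> u @ \oo --> b -> a = b.
Proof. exact: norm_cvg_unique. Qed.

Let cvgD0 (u v : nat -> R) (a : R) : u @ \oo --> a -> v @ \oo --> (0 : R) ->
  (fun n => u n + v n) @ \oo --> a.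
Proof. by move=> ua v0; rewrite -(addr0 a); exact: cvgD. Qed.

Let cvgM0 (c : R) (v : nat -> R) : v @ \oo --> (0 : R) ->
  (fun n => c * v n) @ \oo --> (0 : R).
Proof. by move=> v0; rewrite -(mulr0 c); exact: cvgMl_tmp. Qed.

Definition Zlim k p : R := limn (Zsum k p).

Lemma Zsum_cvg k p : (Zsum k p : nat -> R) @ \oo --> Zlim k p.
Proof.
apply: nondecreasing_is_cvgn; first exact: Zsum_nondecreasing.
exists ((6 / nhalf k) ^+ p * 10) => _ [N _ <-].
apply: le_trans (Zsum_geom _ _ _) _.
by rewrite ler_wpM2l ?Zsum_le10// exprn_ge0// divr_ge0 ?(ltW (nhalf_gt0 _)).
Qed.

Lemma Zlim_shift0 k :
  nhalf k ^+ 2 * Zlim k 0 = (nhalf k + 2^-1) ^+ 2 * Zlim k.+1 0.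
Proof.
apply: (@cvgn_uniq (fun N => nhalf k ^+ 2 * Zsum k 0 N)).
  by apply: cvgMl_tmp; exact: Zsum_cvg.
under eq_fun do rewrite Zsum_shift0.
apply: cvgD0.
  by apply: cvgMl_tmp; exact: Zsum_cvg.
apply: cvgM0.
under eq_fun do rewrite mulrC.
apply: (bounded_mul_cvg0 (C := 1)); last exact: beta_half_cvg0.
  move=> N; rewrite cbin_from_ge0 /= /cbin_from; case: ifP => // _.
  exact: cbin_le1.
by move=> n; exact/ltW/beta_half_gt0.
Qed.

Lemma Zlim_shift k p :
  nhalf k ^+ 2 * Zlim k p.+1 =
  (nhalf k + 2^-1) ^+ 2 * Zlim k.+1 p.+1 + Zlim k.+1 p.
Proof.
apply: (@cvgn_uniq (fun N => nhalf k ^+ 2 * Zsum k p.+1 N)).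
  by apply: cvgMl_tmp; exact: Zsum_cvg.
under eq_fun do rewrite Zsum_shift mulrBl.
apply: cvgD0.
  apply: cvgD; last exact: Zsum_cvg.
  by apply: cvgMl_tmp; exact: Zsum_cvg.
rewrite -(subr0 (0 : R)); apply: cvgB.
  under eq_fun do rewrite -mulrA.
  apply: cvgM0.
  have [C _ aC] := chain_c_bounded k.+1 p.+1.
  apply: (bounded_mul_cvg0 (C := C)); last exact: beta_half_cvg0.
    by move=> n; rewrite chain_c_ge0 aC.
  by move=> n; exact/ltW/beta_half_gt0.
have [C _ aC] := chain_hc_bounded k.+1 p.
apply: (bounded_mul_cvg0 (C := C)); last exact: beta_half_cvg0.
  by move=> n; rewrite chain_hc_ge0 aC.
by move=> n; exact/ltW/beta_half_gt0.
Qed.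

Definition Znorm k p : R := Zlim k p / cbin k ^+ 2.

Let cbin_step k : cbin k.+1 = cbin k * nhalf k / (nhalf k + 2^-1) :> R.
Proof.
have -> : nhalf k + 2^-1 = k.+1%:R :> R by rewrite /nhalf -(natr1 k); lra.
by rewrite -cbinS mulfK.
Qed.

Lemma Znorm_shift0 k : Znorm k.+1 0 = Znorm k 0.
Proof.
have h := Zlim_shift0 k; have c0 := lt0r_neq0 (cbin_gt0 k).
have a0 := nhalf_neq0 k.
rewrite /Znorm cbin_step.
have -> : Zlim k 0 = (nhalf k + 2^-1) ^+ 2 * Zlim k.+1 0 / nhalf k ^+ 2.
  by rewrite -h mulrAC divff ?mul1r// expf_neq0.
have a2 : nhalf k * 2 + 1 != 0 :> R by apply: lt0r_neq0; have := nhalf_gt0 k; lra.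
by field; rewrite a0 c0 a2.
Qed.

Lemma Znorm_shift k p :
  Znorm k p.+1 = Znorm k.+1 p.+1 + Znorm k.+1 p / k.+1%:R ^+ 2.
Proof.
have h := Zlim_shift k p; have c0 := lt0r_neq0 (cbin_gt0 k).
have a0 := nhalf_neq0 k.
have -> : k.+1%:R = nhalf k + 2^-1 :> R by rewrite /nhalf -(natr1 k); lra.
rewrite /Znorm cbin_step.
have -> : Zlim k p.+1 = ((nhalf k + 2^-1) ^+ 2 * Zlim k.+1 p.+1 + Zlim k.+1 p) / nhalf k ^+ 2.
  by rewrite -h mulrAC divff ?mul1r// expf_neq0.
have a2 : nhalf k * 2 + 1 != 0 :> R by apply: lt0r_neq0; have := nhalf_gt0 k; lra.
by field; rewrite a0 c0 a2.
Qed.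

Lemma Znorm_k0 k : Znorm k 0 = Znorm 0 0.
Proof. by elim: k => // k IH; rewrite Znorm_shift0. Qed.

Lemma Znorm_ge0 k p : 0 <= Znorm k p.
Proof.
rewrite divr_ge0 ?sqr_ge0//.
apply: limr_ge; first by apply/cvg_ex; exists (Zlim k p); exact: Zsum_cvg.
by apply: nearW => N; exact: Zsum_ge0.
Qed.

Lemma Znorm_le k p : Znorm k p <= (6 / nhalf k) ^+ p * Znorm 0 0.
Proof.
rewrite -(Znorm_k0 k) /Znorm mulrA ler_wpM2r ?invr_ge0 ?sqr_ge0//.
apply: (@ler_cvg_to _ \oo _ _ (Zsum k p) (fun N => (6 / nhalf k) ^+ p * Zsum k 0 N)).
- exact: Zsum_cvg.
- by apply: cvgMl_tmp; exact: Zsum_cvg.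
- by apply: nearW => N; exact: Zsum_geom.
Qed.

Lemma nhalfV_cvg0 : (fun k => (nhalf k)^-1) @ \oo --> (0 : R).
Proof.
apply/gtr0_cvgV0; first by apply: nearW => n; exact: nhalf_gt0.
apply/cvgryPge => A; near=> n.
apply: le_trans (_ : n%:R <= _); last by rewrite lerDl.
by near: n; exact: nbhs_infty_ger.
Unshelve. all: by end_near. Qed.

Lemma Znorm_cvg0 p : (Znorm ^~ p.+1) @ \oo --> (0 : R).
Proof.
apply: (@squeeze_cvgr _ _ _ _ (fun=> 0)
    (fun k => (6 / nhalf k) ^+ p.+1 * Znorm 0 0)).
- by apply: nearW => k; rewrite Znorm_ge0 Znorm_le.
- exact: cvg_cst.
- rewrite -(mul0r (Znorm 0 0)); apply: cvgMr_tmp.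
  have h : (fun k => 6 / nhalf k) @ \oo --> (0 : R).
    by apply: cvgM0; exact: nhalfV_cvg0.
  elim: p => [|p IH].
    by under eq_fun do rewrite expr1.
  under eq_fun do rewrite exprS.
  by rewrite -(mulr0 0); apply: cvgM.
Qed.

(** By induction on p, the difference of two solutions at p + 1 is constant in
    k, and it tends to 0. *)
Lemma recursion_unique (u v : nat -> nat -> R) :
    (forall k p, u k p.+1 = u k.+1 p.+1 + u k.+1 p / k.+1%:R ^+ 2) ->
    (forall k p, v k p.+1 = v k.+1 p.+1 + v k.+1 p / k.+1%:R ^+ 2) ->
    (forall p, (u ^~ p.+1) @ \oo --> (0 : R)) ->
    (forall p, (v ^~ p.+1) @ \oo --> (0 : R)) ->
    (forall k, u k 0 = v k 0) ->
  forall k p, u k p = v k p.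
Proof.
move=> uS vS uc vc uv0 k p; elim: p k => // p IH k.
have stepd n : u (k + n)%N p.+1 - v (k + n)%N p.+1 = u k p.+1 - v k p.+1.
  elim: n => [|n <-]; first by rewrite addn0.
  rewrite [in RHS]uS [in RHS]vS addnS IH; ring.
apply/eqP; rewrite -subr_eq0; apply/eqP.
apply: (@cvgn_uniq (fun n => u (n + k)%N p.+1 - v (n + k)%N p.+1)).
  by under eq_fun do rewrite addnC stepd; exact: cvg_cst.
rewrite -(subr0 (0 : R)); apply: cvgB.
  by rewrite (cvg_shiftn k (u ^~ p.+1)).
by rewrite (cvg_shiftn k (v ^~ p.+1)).
Qed.
End shifted_sums.

(** * Moments of powers of the cosine *)

Section moments.
Context {R : realType}.
Implicit Types (f g : R -> R) (k m n p : nat).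

(** Divided powers: each is the derivative of the next. *)
Definition divpow p (x : R) : R := x ^+ p / p`!%:R.

Let is_deriveMfun f g (x a b : R) : is_derive x 1 f a -> is_derive x 1 g b ->
  is_derive x 1 (fun y => f y * g y) (a * g x + f x * b).
Proof.
by move=> fa gb; apply: (is_derive_eq (is_deriveM fa gb)); rewrite addrC mulrC.
Qed.

Let is_deriveXfun f n (x a : R) : is_derive x 1 f a ->
  is_derive x 1 (fun y => f y ^+ n.+1) (n.+1%:R * f x ^+ n * a).
Proof.
move=> fa; have := is_deriveX n.+1 fa.
by rewrite /GRing.scale/=; congr is_derive; apply/funext => y; rewrite fctE.
Qed.

Lemma is_derive_divpow p (x : R) : is_derive x 1 (divpow p.+1) (divpow p x).
Proof.
have h := is_deriveMfun (is_deriveXfun p (is_derive_id x 1))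
  (is_derive_cst (p.+1`!%:R^-1 : R) x 1).
apply: (is_derive_eq h); rewrite mulr0 addr0 mulr1 /divpow factS natrM invfM /=.
by rewrite mulrACA divff ?mul1r.
Qed.

Let is_derive_continuous f g : (forall x : R, is_derive x 1 f (g x)) ->
  continuous f.
Proof.
move=> fg x; apply: differentiable_continuous; apply/derivable1_diffP.
by have [] := fg x.
Qed.

Let is_derive_cosX k (x : R) : is_derive x 1 (fun y => cos y ^+ k.+1)
  (- (k.+1%:R * cos x ^+ k * sin x)).
Proof.
have h := is_deriveXfun k (is_derive_cos x).
by apply: (is_derive_eq h); rewrite mulrN.
Qed.

Lemma continuous_moment m k : continuous (fun x : R => divpow m x * cos x ^+ k).
Proof.
apply: (@is_derive_continuous _ (fun x =>
  (if m is m'.+1 then divpow m' x else 0) * cos x ^+ k +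
   divpow m x * (if k is k'.+1 then - (k'.+1%:R * cos x ^+ k' * sin x) else 0))).
move=> x; apply: is_deriveMfun.
  case: m => [|m]; last exact: is_derive_divpow.
  rewrite (_ : divpow 0 = cst 1); first exact: is_derive_cst.
  by apply/funext => y; rewrite /divpow expr0 fact0 divr1.
case: k => [|k]; last exact: is_derive_cosX.
by under eq_fun do rewrite expr0; exact: is_derive_cst.
Qed.

Notation mu := (@lebesgue_measure R).
Notation I := (`[0, pi / 2]%classic : set R).

Lemma pihalf_gt0 : 0 < pi / 2 :> R.
Proof. by rewrite divr_gt0 ?pi_gt0. Qed.

Let integrable_continuous f : continuous f -> mu.-integrable I (EFin \o f).
Proof.
move=> cf; apply: continuous_compact_integrable; first exact: segment_compact.
exact: continuous_subspaceT.
Qed.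

Let Rintegral_derive f g : (forall x : R, is_derive x 1 f (g x)) ->
  continuous g -> \int[mu]_(x in I) g x = f (pi / 2) - f 0.
Proof.
move=> fg cg; have cf := is_derive_continuous fg.
rewrite /Rintegral (continuous_FTC2 pihalf_gt0 (f := g) (F := f))//.
- exact: continuous_subspaceT.
- split.
  + by move=> x _; have [] := fg x.
  + exact/cvg_at_right_filter/cf.
  + exact/cvg_at_left_filter/cf.
- by move=> x _; rewrite derive1E; have [_ ->] := fg x.
Qed.

Definition moment m k : R := \int[mu]_(x in I) (divpow m x * cos x ^+ k).

(** Integrating by parts twice moves two derivatives from x^(m+2) / (m+2)! to
    cos^(k+2). The boundary terms vanish: at 0 through the positive powers of x,
    at pi/2 through the cosine. *)
Lemma moment_rec m k : moment m k.+2 + k.+2%:R ^+ 2 * moment m.+2 k.+2 =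
  k.+2%:R * k.+1%:R * moment m.+2 k.
Proof.
pose F (x : R) := divpow m.+1 x * cos x ^+ k.+2
  + k.+2%:R * (divpow m.+2 x * (cos x ^+ k.+1 * sin x)).
pose G (x : R) := divpow m x * cos x ^+ k.+2
  + (k.+2%:R ^+ 2 * (divpow m.+2 x * cos x ^+ k.+2)
     - k.+2%:R * k.+1%:R * (divpow m.+2 x * cos x ^+ k)).
have FG (x : R) : is_derive x 1 F (G x).
  have h1 := is_deriveMfun (is_derive_divpow m x) (is_derive_cosX k.+1 x).
  have h2 := is_deriveMfun (is_derive_cosX k x) (is_derive_sin x).
  have h3 := is_deriveMfun (is_derive_divpow m.+1 x) h2.
  have h4 := is_deriveMfun (is_derive_cst (k.+2%:R : R) x 1) h3.
  apply: (is_derive_eq (is_deriveD h1 h4)).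
  apply/eqP; rewrite -subr_eq0; apply/eqP.
  transitivity (- (k.+2%:R * k.+1%:R * divpow m.+2 x * cos x ^+ k)
    * (sin x ^+ 2 - (1 - cos x ^+ 2))); last by rewrite sin2cos2 subrr mulr0.
  by rewrite /G -(natr1 k.+1) !exprS expr0 /cst; ring.
have ci a b : mu.-integrable I (EFin \o (fun x : R => divpow a x * cos x ^+ b)).
  by apply: integrable_continuous; exact: continuous_moment.
have cZ (c : R) a b : continuous (fun x : R => c * (divpow a x * cos x ^+ b)).
  by move=> x; apply: cvgMl_tmp; exact: continuous_moment.
have cB : continuous (fun x : R => k.+2%:R ^+ 2 * (divpow m.+2 x * cos x ^+ k.+2)
     - k.+2%:R * k.+1%:R * (divpow m.+2 x * cos x ^+ k)).
  by move=> x; apply: cvgB; exact: cZ.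
have cG : continuous G.
  by move=> x; apply: cvgD; [exact: continuous_moment|exact: cB].
have := Rintegral_derive FG cG.
rewrite /G RintegralD//; last exact: integrable_continuous.
rewrite RintegralB//; try exact: integrable_continuous.
rewrite !RintegralZl// -!/(moment _ _).
rewrite /F cos_pihalf sin0 /divpow !expr0n /= !(mul0r, mulr0, addr0) subrr.
move=> /eqP.
by rewrite addrA subr_eq0 => /eqP.
Qed.

Lemma moment0_rec k : k.+2%:R * moment 0 k.+2 = k.+1%:R * moment 0 k.
Proof.
pose F (x : R) := cos x ^+ k.+1 * sin x.
pose G (x : R) := k.+2%:R * (divpow 0 x * cos x ^+ k.+2)
  - k.+1%:R * (divpow 0 x * cos x ^+ k).
have FG (x : R) : is_derive x 1 F (G x).
  have h := is_deriveMfun (is_derive_cosX k x) (is_derive_sin x).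
  apply: (is_derive_eq h).
  apply/eqP; rewrite -subr_eq0; apply/eqP.
  transitivity (- (k.+1%:R * cos x ^+ k)
    * (sin x ^+ 2 - (1 - cos x ^+ 2))); last by rewrite sin2cos2 subrr mulr0.
  by rewrite /G /divpow fact0 divr1 -(natr1 k.+1) !exprS !expr0; ring.
have cZ (c : R) a b : continuous (fun x : R => c * (divpow a x * cos x ^+ b)).
  by move=> x; apply: cvgMl_tmp; exact: continuous_moment.
have cG : continuous G by move=> x; apply: cvgB; exact: cZ.
have ci a b : mu.-integrable I (EFin \o (fun x : R => divpow a x * cos x ^+ b)).
  by apply: integrable_continuous; exact: continuous_moment.
have := Rintegral_derive FG cG.
rewrite /G RintegralB//; try exact: integrable_continuous.
rewrite !RintegralZl// -!/(moment _ _).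
rewrite /F cos_pihalf sin0 expr0n /= mul0r mulr0 subrr => /eqP.
by rewrite subr_eq0 => /eqP.
Qed.

Lemma moment_k0 m : moment m 0 = divpow m.+1 (pi / 2).
Proof.
rewrite /moment; under eq_Rintegral do rewrite expr0 mulr1.
have cd : continuous (divpow m).
  by have := @continuous_moment m 0; under eq_fun do rewrite expr0 mulr1.
rewrite (Rintegral_derive (is_derive_divpow m) cd).
by rewrite [X in _ - X]/divpow expr0n/= mul0r subr0.
Qed.

Lemma moment_ge0 m k : 0 <= moment m k.
Proof.
apply: Rintegral_ge0 => x /=; rewrite in_itv/= => /andP[x0 x1].
rewrite mulr_ge0 ?divr_ge0 ?exprn_ge0//.
by rewrite cos_ge0_pihalf// x1 andbT (le_trans _ x0)// oppr_le0 (ltW pihalf_gt0).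
Qed.

(** The derivative of sin x - x cos x is x sin x. *)
Lemma mul_cos_le_sin (x : R) : 0 <= x <= pi / 2 -> x * cos x <= sin x.
Proof.
move=> /andP[x0 x1].
pose f (x : R) := sin x - x * cos x.
have fd (y : R) : is_derive y 1 f (y * sin y).
  have h := is_deriveMfun (is_derive_id y 1) (is_derive_cos y).
  apply: (is_derive_eq (is_deriveB (is_derive_sin y) h)).
  by rewrite /=; ring.
have cf := is_derive_continuous fd.
have [c] := MVT_segment x0 (fun y _ => fd y) (continuous_subspaceT cf).
rewrite in_itv/= => /andP[c0 c1].
rewrite /f sin0 mul0r subrr subr0 subr0 => e.
rewrite -subr_ge0 e mulr_ge0// mulr_ge0// sin_ge0_pi// c0 /=.
by have := pi_gt0 R; lra.
Qed.

(** One factor (x cos x)^2 is bounded by sin^2 = 1 - cos^2, which makes the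
    moment small because the moments for p = 0 vary slowly with k. *)
Lemma moment_le m k :
  moment m.+2 k.+2 <= (pi / 2) ^+ m * (moment 0 k - moment 0 k.+2).
Proof.
have ci a b : mu.-integrable I (EFin \o (fun x : R => divpow a x * cos x ^+ b)).
  by apply: integrable_continuous; exact: continuous_moment.
have cB : continuous (fun x : R => divpow 0 x * cos x ^+ k - divpow 0 x * cos x ^+ k.+2).
  by move=> x; apply: cvgB; exact: continuous_moment.
rewrite /moment -RintegralB// -RintegralZl//; last exact: integrable_continuous.
apply: le_Rintegral => //.
  apply: integrable_continuous => x.
  by apply: cvgMl_tmp; exact: cB.
move=> x /=; rewrite in_itv/= => /andP[x0 x1].
have c0 : 0 <= cos x.
  by rewrite cos_ge0_pihalf// x1 andbT (le_trans _ x0)// oppr_le0 (ltW pihalf_gt0).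
rewrite {2 3}/divpow !expr0 fact0 divr1 !mul1r.
have -> : cos x ^+ k - cos x ^+ k.+2 = (sin x ^+ 2) * cos x ^+ k.
  by rewrite sin2cos2 !exprS; ring.
have -> : divpow m.+2 x * cos x ^+ k.+2 =
    divpow m.+2 x * cos x ^+ 2 * cos x ^+ k.
  by rewrite !exprS; ring.
rewrite mulrA ler_wpM2r ?exprn_ge0//.
have h := mul_cos_le_sin (introT andP (conj x0 x1)).
apply: le_trans (_ : x ^+ m * (x * cos x) ^+ 2 <= _).
  have -> : x ^+ m * (x * cos x) ^+ 2 = x ^+ m.+2 * cos x ^+ 2.
    by rewrite !exprS; ring.
  rewrite ler_wpM2r ?exprn_ge0//.
  rewrite /divpow ler_pdivrMr ?ltr0n ?fact_gt0// ler_peMr ?exprn_ge0//.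
  by rewrite ler1n fact_gt0.
rewrite ler_pM ?exprn_ge0 ?mulr_ge0//.
  by rewrite lerXn2r ?nnegrE// (le_trans x0).
by rewrite lerXn2r ?nnegrE ?mulr_ge0// (le_trans _ h) ?mulr_ge0.
Qed.
End moments.

(** * Comparison with the moments *)

Section wallis.
Context {R : realType}.
Implicit Types (k m n p : nat).

(** The factor 4^p makes the recursion [nmoment_shift] the one of [Znorm]: the
    exponent 2k of the cosine yields 4 (k+1)^2 in [moment_rec]. *)
Definition nmoment k p : R := 4 ^+ p * moment p.*2 k.*2 / moment 0 k.*2.

Lemma moment0_gt0 k : 0 < moment 0 k.*2 :> R.
Proof.
elim: k => [|k IH].
  by rewrite moment_k0 /divpow factS fact0 expr1 divr1 pihalf_gt0.
have h : 0 < k.*2.+2%:R * moment 0 k.*2.+2 :> R by rewrite moment0_rec mulr_gt0.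
by rewrite doubleS; move: h; rewrite pmulr_rgt0.
Qed.

Lemma nmomentk0 k : nmoment k 0 = 1.
Proof. by rewrite /nmoment expr0 mul1r divff// gt_eqF ?moment0_gt0. Qed.

Lemma nmoment_shift k p :
  nmoment k p.+1 = nmoment k.+1 p.+1 + nmoment k.+1 p / k.+1%:R ^+ 2.
Proof.
have h := @moment_rec R p.*2 k.*2; have h0 := @moment0_rec R k.*2.
have a0 := lt0r_neq0 (moment0_gt0 k); have a1 := lt0r_neq0 (moment0_gt0 k.+1).
rewrite /nmoment !doubleS in a1 *.
have e2 : k.*2.+2%:R = 2 * k.+1%:R :> R.
  by rewrite -doubleS -mul2n natrM.
have k1 : k.+1%:R != 0 :> R by [].
have k2 : k.*2.+1%:R != 0 :> R by [].
have e0 : moment 0 k.*2 = 2 * k.+1%:R * moment 0 k.*2.+2 / k.*2.+1%:R :> R.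
  by rewrite -e2 h0 mulrAC divff// mul1r.
have e1 : moment p.*2.+2 k.*2 = (moment p.*2 k.*2.+2
    + (2 * k.+1%:R) ^+ 2 * moment p.*2.+2 k.*2.+2) / (2 * k.+1%:R * k.*2.+1%:R) :> R.
  by rewrite -e2 h mulrAC divff ?mul1r// mulf_neq0// e2 mulf_neq0// pnatr_eq0.
rewrite e0 e1 exprS; move: a1 k1 k2; clear.
move: (moment 0 k.*2.+2) (k.+1%:R) (k.*2.+1%:R) => a b c a1 k1 k2.
by field; rewrite a1 k1 k2.
Qed.

Lemma nmoment_ge0 k p : 0 <= nmoment k p.
Proof. by rewrite divr_ge0 ?mulr_ge0 ?exprn_ge0 ?moment_ge0. Qed.

Lemma nmoment_le k p :
  nmoment k.+1 p.+1 <= 4 ^+ p.+1 * (pi / 2) ^+ p.*2 / nhalf k.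
Proof.
have h := @moment_le R p.*2 k.*2; have h0 := @moment0_rec R k.*2.
have a1 := moment0_gt0 k.+1; rewrite doubleS in a1.
have k2 : 0 < k.*2.+1%:R :> R by [].
have nhalfE : k.*2.+1%:R = 2 * nhalf k :> R.
  by rewrite -natr1 -mul2n natrM /nhalf; lra.
have e : moment 0 k.*2 - moment 0 k.*2.+2 = moment 0 k.*2.+2 / k.*2.+1%:R :> R.
  have -> : moment 0 k.*2 = k.*2.+2%:R * moment 0 k.*2.+2 / k.*2.+1%:R :> R.
    by rewrite h0 mulrAC divff ?mul1r ?gt_eqF.
  rewrite -(natr1 k.*2.+1); field.
  by rewrite nat1r gt_eqF.
rewrite e in h.
rewrite /nmoment !doubleS ler_pdivrMr// -!mulrA ler_wpM2l ?exprn_ge0//.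
apply: le_trans h _; rewrite ler_wpM2l ?exprn_ge0 ?(ltW pihalf_gt0)//.
rewrite mulrC ler_wpM2r ?(ltW a1)// nhalfE lef_pV2 ?posrE ?mulr_gt0 ?nhalf_gt0//.
by have := @nhalf_gt0 R k; lra.
Qed.

Lemma nmoment_cvg0 p : (nmoment ^~ p.+1) @ \oo --> (0 : R).
Proof.
rewrite -cvg_shiftS.
apply: (@squeeze_cvgr _ _ _ _ (fun=> 0)
    (fun k => 4 ^+ p.+1 * (pi / 2) ^+ p.*2 / nhalf k)).
- by apply: nearW => k; rewrite nmoment_ge0 nmoment_le.
- exact: cvg_cst.
- rewrite -(mulr0 (4 ^+ p.+1 * (pi / 2) ^+ p.*2)); apply: cvgMl_tmp.
  exact: nhalfV_cvg0.
Qed.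

Lemma nmoment0 p : nmoment 0 p = pi ^+ p.*2 / (p.*2.+1)`!%:R.
Proof.
rewrite /nmoment !moment_k0 /divpow (_ : 1`! = 1%N)// divr1 expr1.
have h := lt0r_neq0 (factr_gt0 p.*2.+1 : 0 < _ :> R).
have hp := lt0r_neq0 (pi_gt0 R).
rewrite exprS expr_div_n.
have -> : 2 ^+ p.*2 = 4 ^+ p :> R by rewrite -mul2n exprM; congr (_ ^+ _); ring.
have h4 : 4 ^+ p != 0 :> R by rewrite expf_neq0// pnatr_eq0.
move: h h4 hp; move: (p.*2.+1`!%:R) (4 ^+ p) (@pi R) => a b c ha hb hc.
by field; rewrite ha hb hc.
Qed.

(** Basel's sum: by [nmoment_shift] at p = 0 the partial sums are the
    differences of the normalised second moments. *)
Lemma sum_inv_sqr : (fun n => \sum_(i < n) (i.+1%:R ^+ 2)^-1) @ \oo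
  --> (pi ^+ 2 / 6 : R).
Proof.
have -> : pi ^+ 2 / 6 = nmoment 0 1 :> R by rewrite nmoment0.
have e n : \sum_(i < n) (i.+1%:R ^+ 2)^-1 = nmoment 0 1 - nmoment n 1 :> R.
  elim: n => [|n IH]; first by rewrite big_ord0 subrr.
  rewrite big_ord_recr /= IH (nmoment_shift n 0) nmomentk0; ring.
under eq_fun do rewrite e.
have := cvgB (cvg_cst (nmoment 0 1) : _ @ \oo --> _) (nmoment_cvg0 0).
by rewrite subr0; apply.
Qed.

(** Since 1 / a_i^2 = 4 / (2i+1)^2, the partial sum is obtained from Basel's by
    removing the even terms. *)
Lemma sum_inv_nhalf_sqr : (fun n => \sum_(i < n) (nhalf i ^+ 2)^-1) @ \oo
  --> (pi ^+ 2 / 2 : R).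
Proof.
pose S n : R := \sum_(i < n) (i.+1%:R ^+ 2)^-1.
have e n : \sum_(i < n) (nhalf i ^+ 2)^-1 = 4 * S n.*2 - S n :> R.
  elim: n => [|n IH]; first by rewrite /S !big_ord0 mulr0 subrr.
  rewrite doubleS /S !big_ord_recr /= IH -/(S n) -/(S n.*2).
  have -> : nhalf n = n.*2.+1%:R / 2 :> R by rewrite /nhalf -(natr1 n.*2) -mul2n natrM; lra.
  have -> : n.*2.+2%:R = 2 * n.+1%:R :> R by rewrite -doubleS -mul2n natrM.
  have : n.+1%:R != 0 :> R by []. have : n.*2.+1%:R != 0 :> R by [].
  move: (n.+1%:R) (n.*2.+1%:R) => a b hb ha.
  by field; rewrite ha hb.
under eq_fun do rewrite e.
have -> : pi ^+ 2 / 2 = 4 * (pi ^+ 2 / 6) - pi ^+ 2 / 6 :> R by field.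
apply: cvgB; last exact: sum_inv_sqr.
apply: cvgMl_tmp.
apply: (@cvg_comp _ _ _ double S \oo \oo); last exact: sum_inv_sqr.
apply/cvgnyPge => A; near=> n.
by rewrite -addnn (leq_trans _ (leq_addr _ _))//; near: n; exact: nbhs_infty_ge.
Unshelve. all: by end_near. Qed.

Lemma Znorm00 : Znorm 0 0 = pi ^+ 2 :> R.
Proof.
rewrite /Znorm cbin0 expr1n divr1 /Zlim.
apply/cvg_lim => //.
rewrite (funext Zsum00).
have -> : pi ^+ 2 = 2 * (pi ^+ 2 / 2) :> R by field.
by apply: cvgMl_tmp; exact: sum_inv_nhalf_sqr.
Qed.

Lemma ZnormE k p : Znorm k p = pi ^+ 2 * nmoment k p :> R.
Proof.
apply: (recursion_unique (u := Znorm) (v := fun k p => pi ^+ 2 * nmoment k p)) => [||p'|p'|k'].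
- exact: Znorm_shift.
- by move=> k' p'; rewrite nmoment_shift mulrDr mulrA.
- exact: Znorm_cvg0.
- by rewrite -(mulr0 (pi ^+ 2)); apply: cvgMl_tmp; exact: nmoment_cvg0.
- by rewrite Znorm_k0 Znorm00 nmomentk0 mulr1.
Qed.

Lemma Zsum0_cvg p :
  (Zsum 0 p : nat -> R) @ \oo --> pi ^+ p.+1.*2 / (p.*2.+1)`!%:R.
Proof.
suff -> : pi ^+ p.+1.*2 / (p.*2.+1)`!%:R = Zlim 0 p :> R by exact: Zsum_cvg.
have := ZnormE 0 p.
rewrite /Znorm cbin0 expr1n divr1 => ->.
by rewrite nmoment0 doubleS -addn2 addnC exprD mulrA.
Qed.
End wallis.

(** * From sums over tuples to iterated sums *)

Section chains.
Context {R : realType}.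
Implicit Types (g : nat -> R) (s : seq nat) (i j n p : nat).

Lemma sorted_ltn_rcons2 s i j :
  sorted ltn (rcons (rcons s i) j) = sorted ltn (rcons s i) && (i < j)%N.
Proof. by case: s => [|x s] /=; rewrite ?andbT// !rcons_path last_rcons. Qed.

(** Sums over increasing sequences are evaluated by peeling off the last
    entry. *)
Lemma esum_chain_last (D : set nat) p (a : seq nat -> \bar R) :
  (forall s, (0 <= a s)%E) ->
  (\esum_(s in [set s | [/\ size s = p.+1, sorted ltn s & D (last 0%N s)]]) a s =
  \esum_(j in D) \esum_(s in [set s | size s = p /\ sorted ltn (rcons s j)])
    a (rcons s j))%E.
Proof.
move=> a0; rewrite esum_esum//.
apply: (reindex_esum _ _ (fun k : nat * seq nat => rcons k.2 k.1)); split.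
- by move=> [j s] /= [Dj [sp ss]]; rewrite size_rcons sp last_rcons.
- move=> [j s] [j' s'] _ _ /= e.
  by have [-> ->] := rcons_inj e.
- move=> s [sp ss Ds]; case/lastP: s sp ss Ds => // s j.
  rewrite size_rcons last_rcons => -[sp] ss Dj.
  by exists (j, s).
Qed.

Definition chain_weight g s : R :=
  g (head 0%N s) * \prod_(x <- s) (nhalf x ^+ 2)^-1.

Lemma chain_weight_ge0 g s : (forall m, 0 <= g m) -> 0 <= chain_weight g s.
Proof.
move=> g0; rewrite mulr_ge0// prodr_ge0// => x _.
by rewrite invr_ge0 sqr_ge0.
Qed.

Lemma chain_scale g (c : R) p m :
  chain (fun m => g m * c) p m = chain g p m * c.
Proof.
elim: p m => [//|p IH] m /=; rewrite mulr_suml; apply: eq_bigr => i _.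
by rewrite IH mulrAC.
Qed.

Lemma esum_chain g p j : (forall m, 0 <= g m) ->
  (\esum_(s in [set s | size s = p /\ sorted ltn (rcons s j)])
    (chain_weight g (rcons s j))%:E = (chain g p j / nhalf j ^+ 2)%:E)%E.
Proof.
move=> g0; elim: p g g0 j => [|p IH] g g0 j.
  rewrite (_ : [set s | _] = [set [::]]); last first.
    apply/seteqP; split=> s /= => [[/size0nil->]//|->//].
  rewrite esum_set1 ?lee_fin ?chain_weight_ge0//.
  by rewrite /chain_weight /= big_seq1.
rewrite (_ : [set s | _] = [set s | [/\ size s = p.+1, sorted ltn s &
    [set i | (i < j)%N] (last 0%N s)]]); last first.
  apply/seteqP; split=> s /=; case/lastP: s => [[]//|s i].
    by rewrite sorted_ltn_rcons2 last_rcons => -[-> /andP[]].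
  by rewrite sorted_ltn_rcons2 last_rcons => -[-> -> ->].
rewrite (esum_chain_last _ _ (a := fun s => (chain_weight g (rcons s j))%:E)); last first.
  by move=> s; rewrite lee_fin chain_weight_ge0.
pose gj m := g m / nhalf j ^+ 2.
have gj0 m : 0 <= gj m by rewrite divr_ge0 ?sqr_ge0.
transitivity (\esum_(i in `I_j) (chain gj p i / nhalf i ^+ 2)%:E)%E.
  apply: eq_esum => i _; rewrite -IH//; apply: eq_esum => s _.
  congr EFin; rewrite /chain_weight -!cats1 !big_cat !big_seq1 /=.
  have -> : head 0%N ((s ++ [:: i]) ++ [:: j]) = head 0%N (s ++ [:: i]).
    by case: s.
  by rewrite /gj; ring.
rewrite esum_fset//; last first.
  by move=> i _; rewrite lee_fin divr_ge0 ?chain_ge0 ?sqr_ge0.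
rewrite -fsbig_ord sumEFin /= mulr_suml; congr EFin.
by apply: eq_bigr => i _; rewrite chain_scale mulrAC.
Qed.

(** The weight of the last index may be moved into the function g of the first
    one, as it is constant in the inner sum. *)
Lemma Z_chain (k : seq nat) p g (E : nat -> R) :
    size k = p.+1 -> (forall m, 0 <= g m) -> (forall m, 0 <= E m) ->
    (forall n : (size k).-tuple nat, Zterm R n =
      chain_weight g n * E (last 0%N n)) ->
  (Z R k = \esum_(j in [set: nat]) (chain g p j / nhalf j ^+ 2 * E j)%:E)%E.
Proof.
move=> sk g0 E0 Zt; rewrite /Z.
pose a (s : seq nat) := (chain_weight g s * E (last 0%N s))%:E.
have a0 s : (0 <= a s)%E by rewrite lee_fin mulr_ge0 ?chain_weight_ge0.
transitivity (\esum_(s in [set s | [/\ size s = p.+1, sorted ltn s &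
    [set: nat] (last 0%N s)]]) a s)%E.
  rewrite [RHS](reindex_esum [set n : (size k).-tuple nat | sorted ltn n] _
    (fun t : (size k).-tuple nat => tval t)).
    by apply: eq_esum => n _; rewrite Zt.
  split.
  - by move=> t /= st; split=> //; rewrite -sk; exact: size_tuple.
  - by move=> m n _ _ /val_inj.
  - move=> s [sp ss _]; rewrite -sk in sp.
    by exists (Tuple (introT eqP sp)).
rewrite esum_chain_last//; apply: eq_esum => j _.
pose gj m := g m * E j.
have gj0 m : 0 <= gj m by rewrite mulr_ge0.
have -> : chain g p j / nhalf j ^+ 2 * E j = chain gj p j / nhalf j ^+ 2.
  by rewrite chain_scale mulrAC.
rewrite -esum_chain//; apply: eq_esum => s _.
by rewrite /a last_rcons /chain_weight /gj mulrAC.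
Qed.

Lemma prod_tuple_zip (k : seq nat) (n : (size k).-tuple nat) :
  \prod_(i < size k) (nhalf (tnth n i)) ^+ nth 0%N k i =
  \prod_(x <- zip n k) (nhalf x.1 : R) ^+ x.2.
Proof.
rewrite (big_nth (0%N, 0%N)) size_zip size_tuple minnn big_mkord.
by apply: eq_bigr => i _; rewrite nth_zip ?size_tuple// (tnth_nth 0%N).
Qed.

Lemma prod_zip_nseq2 s :
  \prod_(x <- zip s (nseq (size s) 2%N)) (nhalf x.1 : R) ^+ x.2 =
  \prod_(x <- s) nhalf x ^+ 2.
Proof. by elim: s => [|x s IH] /=; rewrite ?big_nil// !big_cons IH. Qed.

Lemma Zterm_twos p (n : (size (nseq p.+1 2%N)).-tuple nat) :
  Zterm R n = chain_weight cbin n * (cbin (last 0%N n))^-1.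
Proof.
rewrite /Zterm /chain_weight -[X in _ * X = _]invf_div -!/(cbin _).
congr (_ * _ * _).
have sn : size n = p.+1 by rewrite size_tuple size_nseq.
rewrite prodfV; congr (_^-1).
transitivity (\prod_(x <- zip n (nseq p.+1 2%N)) (nhalf x.1 : R) ^+ x.2).
  by rewrite -prod_tuple_zip.
by move: sn; move: (tval n) => s <-; exact: prod_zip_nseq2.
Qed.

(** Against the exponents 2, ..., 2 the first index gains a factor a and the
    last one loses a factor a. *)
Lemma Zterm_one_twos_three p
    (n : (size (1%N :: nseq p 2%N ++ [:: 3%N])).-tuple nat) :
  Zterm R n = chain_weight (fun m => nhalf m * cbin m) n * beta_half (last 0%N n).
Proof.
rewrite /Zterm /chain_weight -[X in _ * X = _]invf_div -!/(cbin _) /beta_half.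
rewrite prod_tuple_zip prodfV.
case: n => n /= /eqP; rewrite size_cat size_nseq addn1.
case: n => // x n [] /=; case/lastP: n => // t y.
rewrite size_rcons => -[st].
rewrite last_rcons /= !big_cons cats1 zip_rcons ?size_nseq//.
rewrite -st !big_rcons /= prod_zip_nseq2.
have P0 : \prod_(j <- t) (nhalf j : R) ^+ 2 != 0.
  by rewrite prodf_seq_neq0; apply/allP => j _ /=; rewrite expf_neq0 ?nhalf_neq0.
have c0 := lt0r_neq0 (@cbin_gt0 R y).
have x0 := @nhalf_neq0 R x; have y0 := @nhalf_neq0 R y.
move: P0 c0 x0 y0; move: (\prod_(_ <- t) _) (cbin y) (nhalf x) (nhalf y) => P c a b.
by move=> P0 c0 a0 b0; field; rewrite P0 c0 a0 b0.
Qed.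

Lemma Z_sum p :
  (Z R (nseq p.+2 2%N) + Z R (1%N :: nseq p 2%N ++ [:: 3%N]))%E =
  (limn (Zsum 0 p.+1 : nat -> R))%:E.
Proof.
have c0 m : 0 <= cbin m :> R by exact/ltW/cbin_gt0.
have h0 m : 0 <= nhalf m :> R by exact/ltW/nhalf_gt0.
have s0 : cbin_from 0 = cbin :> (nat -> R).
  by apply/funext => m; rewrite /cbin_from subn0.
rewrite (Z_chain (p := p.+1) (g := cbin) (E := fun j => (cbin j)^-1)); last first.
- exact: Zterm_twos.
- by move=> m; rewrite invr_ge0.
- by [].
- by rewrite size_nseq.
rewrite (Z_chain (p := p.+1) (g := fun m => nhalf m * cbin m) (E := beta_half)); last first.
- exact: Zterm_one_twos_three.
- by move=> m; exact/ltW/beta_half_gt0.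
- by move=> m; rewrite mulr_ge0.
- by rewrite /= size_cat size_nseq addn1.
have g0 m : 0 <= nhalf m * cbin m :> R by rewrite mulr_ge0.
have ci0 m : 0 <= beta_half m :> R by exact/ltW/beta_half_gt0.
rewrite -esumD; last 2 first.
- by move=> j _; rewrite lee_fin mulr_ge0 ?invr_ge0// divr_ge0 ?sqr_ge0// chain_ge0.
- by move=> j _; rewrite lee_fin mulr_ge0// divr_ge0 ?sqr_ge0// chain_ge0.
pose u j : R := beta_half (j + 0) * (chain_c 0 p.+1 j / nhalf j + chain_hc 0 p.+1 j / nhalf j ^+ 2).
rewrite (eq_esum (b := fun j => (u j)%:E)); last first.
  move=> j _; rewrite -EFinD; congr EFin.
  rewrite /u /chain_c /chain_hc s0 addn0 /beta_half.
  have cj := lt0r_neq0 (@cbin_gt0 R j); have aj := @nhalf_neq0 R j.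
  by field; rewrite cj aj.
rewrite -nneseries_esumT; last first.
  move=> j; rewrite lee_fin mulr_ge0// addr_ge0// divr_ge0 ?sqr_ge0 ?chain_c_ge0 ?chain_hc_ge0//.
apply/cvg_lim => //.
under eq_fun do rewrite sumEFin big_mkord.
apply: cvg_EFin; first by apply: nearW.
exact: Zsum_cvg.
Qed.
End chains.

Theorem corollary1p5 (R : realType) (r : nat) (hr : (2 <= r)%N) :
  (Z R (nseq r 2%N) + Z R (1%N :: nseq (r - 2) 2%N ++ [:: 3%N]))%E
  = ((pi ^+ (2 * r) / ((2 * r - 1)`!)%:R)%R)%:E.
Proof.
case: r hr => [|[|p]]// _.
rewrite subSS subSS subn0 Z_sum (cvg_lim _ (@Zsum0_cvg R p.+1))//.
by rewrite mul2n doubleS subSS subn0.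
Qed.
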